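(* Let $k$ and $i$ be integers with $1\le i\le k/2$, $k\equiv 2\pmod 3$ and $i\equiv 0\pmod 3$. Then for all integers $n\ge 0$: (1) if $k-i\equiv 2\pmod 9$, then $S_{k,i}(9n+5)\equiv S_{k,i}(9n+8)\equiv 0\pmod 4$; (2) if $k-i\equiv 5\pmod 9$, then $S_{k,i}(9n+2)\equiv S_{k,i}(9n+8)\equiv 0\pmod 4$; (3) if $k-i\equiv 8\pmod 9$, then $S_{k,i}(9n+2)\equiv S_{k,i}(9n+5)\equiv 0\pmod 4$.
   Context: Write $(a;q)_\infty=\prod_{m\ge 0}(1-aq^m)$, $(a)_\infty=(a;q)_\infty$, and $(a_1,\ldots,a_r;q)_\infty=(a_1;q)_\infty\cdots(a_r;q)_\infty$. For integers $k,i$ with $1\le i\le k/2$, the integers $S_{k,i}(n)$, $n\ge 0$, are given by the generating function $$\sum_{n\ge 0}S_{k,i}(n)q^n=\frac{(-q)_\infty\,(q^i,q^{k-i},q^k;q^k)_\infty}{(q)_\infty}.$$ Combinatorially (an overpartition of $n$ is a partition of $n$ in which the first occurrence of each integer may be overlined): if $i<k/2$, $S_{k,i}(n)$ is the number of overpartitions of $n$ whose non-overlined parts are not congruent to $0,\pm i$ modulo $k$; if $i=k/2$, it is the number of overpartitions of $n$ with no part divisible by $k/2$. *)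

(* Defs.v *)
From HB Require Import structures.
From mathcomp Require Import all_boot all_order all_algebra.

Set Implicit Arguments.
Unset Strict Implicit.
Unset Printing Implicit Defensive.

Import Order.TTheory GRing.Theory Num.Theory.
Local Open Scope ring_scope.

(* A formal power series in q over the integers is its coefficient sequence;
   polynomials in {poly int} have their indeterminate 'X standing for q. *)
Definition qseries := nat -> int.

Definition qs_mul (f g : qseries) : qseries :=
  fun n => \sum_(j < n.+1) f j * g (n - j)%N.

(* Long division: the first n coefficients of the series h with h * g = f,
   for g with constant term 1 (see qs_divK). *)
Fixpoint qs_div_coefs (f g : qseries) (n : nat) : seq int :=
  if n is m.+1 then
    let h := qs_div_coefs f g m in
    rcons h (f m - \sum_(j < m) h`_j * g (m - j)%N)
  else [::].

Definition qs_div (f g : qseries) : qseries :=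
  fun n => (qs_div_coefs f g n.+1)`_n.

(* (a; b)_oo = \prod_(m >= 0) (1 - a b^m) for polynomials a, b in q such that
   b has no constant term. The factors with m > n do not affect the coefficient
   of q^n, so the finite product below suffices (see coef_qpoch). *)
Definition qpoch (a b : {poly int}) : qseries :=
  fun n => (\prod_(m < n.+1) (1 - a * b ^+ m))`_n.

(* S_{k,i}(n): the coefficient of q^n in
   (-q; q)_oo (q^i, q^(k-i), q^k; q^k)_oo / (q; q)_oo. *)
Definition S_ki (k i : nat) : qseries :=
  qs_div
    (qs_mul (qpoch (- 'X) 'X)
       (qs_mul (qpoch 'X^i 'X^k)
          (qs_mul (qpoch 'X^(k - i) 'X^k) (qpoch 'X^k 'X^k))))
    (qpoch 'X 'X).

Lemma coef_qpoch (a b : {poly int}) (n N : nat) :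
  b`_0 = 0 -> (n < N)%N ->
  (\prod_(m < N) (1 - a * b ^+ m))`_n = qpoch a b n.
Proof.
move=> b0; elim: N => // N IHN; rewrite ltnS leq_eqVlt => /predU1P[-> //|ltnN].
have [c Eb] : exists c, b = c * 'X.
  exists (drop_poly 1 b); rewrite -[LHS](poly_take_drop 1) expr1.
  rewrite [take_poly _ _](_ : _ = 0) ?add0r //.
  by apply/polyP => -[|j]; rewrite coef_take_poly coef0 //= b0.
rewrite big_ord_recr /= mulrBr mulr1 coefB IHN //.
by rewrite Eb exprMn !mulrA coefMXn ltnN subr0.
Qed.

Lemma size_qs_div_coefs (f g : qseries) n : size (qs_div_coefs f g n) = n.
Proof. by elim: n => //= n IHn; rewrite size_rcons IHn. Qed.

Lemma nth_qs_div_coefs (f g : qseries) n j :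
  (j < n)%N -> (qs_div_coefs f g n)`_j = qs_div f g j.
Proof.
elim: n => // n IHn; rewrite ltnS leq_eqVlt => /predU1P[-> //|ltjn].
by rewrite /= nth_rcons size_qs_div_coefs ltjn IHn.
Qed.

Lemma qs_divK (f g : qseries) : g 0%N = 1 -> qs_mul (qs_div f g) g =1 f.
Proof.
move=> g0 n; rewrite /qs_mul big_ord_recr /= subnn g0 mulr1.
rewrite {2}/qs_div /= nth_rcons size_qs_div_coefs ltnn eqxx addrC.
rewrite (eq_bigr (fun j : 'I_n => qs_div f g j * g (n - j)%N)) ?subrK // => j _.
by rewrite nth_qs_div_coefs.
Qed.

Lemma qpoch0 (a b : {poly int}) : qpoch a b 0 = 1 - a`_0.
Proof. by rewrite /qpoch big_ord1 expr0 mulr1 coefB coef1. Qed.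

Lemma S_kiP (k i : nat) :
  qs_mul (S_ki k i) (qpoch 'X 'X) =1
  qs_mul (qpoch (- 'X) 'X)
    (qs_mul (qpoch 'X^i 'X^k)
       (qs_mul (qpoch 'X^(k - i) 'X^k) (qpoch 'X^k 'X^k))).
Proof. by apply: qs_divK; rewrite qpoch0 coefX subr0. Qed.

(* Main.v *)
Require Import Defs.
From mathcomp Require Import all_boot all_order all_algebra.
From mathcomp Require Import zify ring.

(** Multiplying the generating function by P = (q)_oo / (-q)_oo leaves
    J = (q^i, q^(k-i), q^k; q^k)_oo, and P = (q, q, q^2; q^2)_oo is itself the
    case (k, i) = (2, 1) of J. Since P = 1 (mod 2), P^2 = 1 (mod 4), so
    S_{k,i} = J / P = J P (mod 4). By the Jacobi triple product the exponents
    in J are k n(n-1)/2 + i n (n in Z) and those in P are squares; a sum of two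
    such exponents that is 2 modulo 3 is k - i modulo 9, so J P has no term at
    the exponents in question. Only the supports of J and P matter, and they
    come from the finite triple product with Gaussian binomials. *)

Set Implicit Arguments.
Unset Strict Implicit.

Local Open Scope ring_scope.
Import GRing.Theory.

(** * Gaussian binomials and the finite Jacobi triple product *)

Section FiniteTripleProduct.

Variable R : comNzRingType.
Implicit Types x z w : R.

Fixpoint gauss_binom x (n j : nat) : R :=
  match n, j with
  | _, 0 => 1
  | 0, _.+1 => 0
  | n'.+1, j'.+1 => gauss_binom x n' j' + x ^+ j * gauss_binom x n' j
  end.

Lemma gauss_binom0 x n : gauss_binom x n 0 = 1.
Proof. by case: n. Qed.

Lemma gauss_binomS x n j :
  gauss_binom x n.+1 j.+1 =
  gauss_binom x n j + x ^+ j.+1 * gauss_binom x n j.+1.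
Proof. by []. Qed.

Lemma gauss_binom_small x n j : (n < j)%N -> gauss_binom x n j = 0.
Proof.
elim: n j => [|n IHn] [|j] //= ltnj.
by rewrite !IHn ?mulr0 ?addr0 // ltnW.
Qed.

(** The quotient formula for [r+s, r] with its denominator cleared. Pascal's rule reduces it to 1 -
    x^(r+s+2) = (1 - x^(r+1)) + x^(r+1) (1 - x^(s+1)). *)
Lemma gauss_binom_prod x r s :
  gauss_binom x (r + s) r * \prod_(m < r) (1 - x ^+ m.+1) =
  \prod_(m < r) (1 - x ^+ (s + m).+1).
Proof.
elim: r s => [|r IHr] s; first by rewrite gauss_binom0 !big_ord0 mulr1.
elim: s => [|s IHs].
  rewrite addn0 [gauss_binom _ _ _]/= [gauss_binom _ r r.+1]gauss_binom_small //.
  rewrite mulr0 addr0.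
  have := IHr 0%N; rewrite addn0 !big_ord_recr /= => IHr0.
  by rewrite mulrA IHr0.
rewrite addSn gauss_binomS mulrDl -mulrA -addSnnS IHs addSnnS.
rewrite [X in gauss_binom _ _ _ * X]big_ord_recr /= mulrA IHr.
rewrite big_ord_recl addn0 [in RHS]big_ord_recr /= /bump /=.
under [in X in _ + X]eq_bigr => m _ do rewrite add1n -addSnnS.
by rewrite -[(s.+1 + r).+1]addnS exprD; ring.
Qed.

(** Pascal's rule moved onto the weights, which serves the induction on either factor of the triple
    product. *)
Lemma sum_gauss_binomS x n (a : nat -> R) :
  \sum_(j < n.+2) gauss_binom x n.+1 j * a j =
  \sum_(j < n.+1) gauss_binom x n j * (a j.+1 + x ^+ j * a j).
Proof.
rewrite big_ord_recl /= mul1r.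
under [in LHS]eq_bigr => j _ do rewrite /bump /= add1n mulrDl.
under [in RHS]eq_bigr => j _ do rewrite mulrDr.
rewrite !big_split /= addrCA; congr (_ + _).
rewrite big_ord_recr /= gauss_binom_small // mulr0 mul0r addr0.
rewrite [RHS]big_ord_recl /= gauss_binom0 !mul1r; congr (_ + _).
by apply: eq_bigr => j _; rewrite /bump /= add1n; ring.
Qed.

(* With n = j - N in Z, this is z^n x^(n(n-1)/2), where z^-1 = w / x. *)
Definition theta_term z w x (N j : nat) : R :=
  if (N <= j)%N then z ^+ (j - N) * x ^+ 'C(j - N, 2)
  else w ^+ (N - j) * x ^+ 'C(N - j, 2).

Lemma theta_termS z w x N j : theta_term z w x N.+1 j.+1 = theta_term z w x N j.
Proof. by rewrite /theta_term ltnS !subSS. Qed.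

(** The effect of the new factor [1 + w * x ^+ N] on a term: raising [N] lowers the index n = j - N
    by one. *)
Lemma theta_term_mul z w x N j : z * w = x ->
  w * x ^+ N * theta_term z w x N j = x ^+ j * theta_term z w x N.+1 j.
Proof.
move=> zwx; rewrite /theta_term; case: (ltnP N j) => [ltNj | lejN].
  rewrite ltnW // -(subnKC ltNj); set d := (j - N.+1)%N.
  have -> : (N.+1 + d - N = d.+1)%N by lia.
  have -> : (N.+1 + d - N.+1 = d)%N by lia.
  by rewrite binS bin1 exprD (exprD x N.+1) !exprS -zwx; ring.
rewrite -(subnK lejN); set d := (N - j)%N.
have -> : (d + j <= j)%N = (d == 0)%N by lia.
have -> : (d + j - j = d)%N by lia.
have -> : ((d + j).+1 - j = d.+1)%N by lia.
have -> : (j - (d + j) = 0)%N by lia.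
case: eqP => [->|_]; first by rewrite !expr0 expr1 add0n; ring.
by rewrite binS bin1 !exprD exprS; ring.
Qed.

Lemma finite_triple_product z w x M N : z * w = x ->
  \prod_(m < M) (1 + z * x ^+ m) * \prod_(m < N) (1 + w * x ^+ m) =
  \sum_(j < (M + N).+1) gauss_binom x (M + N) j * theta_term z w x N j.
Proof.
move=> zwx; elim: N => [|N IHN].
  (* For [N = 0] this is the q-binomial theorem. Peeling off the factor at m = 0 replaces z by z x,
     hence the general [z] and the dropped link to [w]. *)
  rewrite big_ord0 mulr1 addn0 => {zwx}; elim: M z => [|M IHM] z.
    by rewrite big_ord0 big_ord1 /theta_term /= !mul1r.
  rewrite sum_gauss_binomS big_ord_recl /= mulr1.
  under eq_bigr => m _ do rewrite /bump /= add1n exprS mulrA.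
  rewrite IHM mulr_sumr; apply: eq_bigr => j _.
  rewrite mulrCA; congr (_ * _).
  rewrite /theta_term /= !subn0 binS bin1 exprD exprMn exprS; ring.
rewrite big_ord_recr /= mulrA IHN addnS sum_gauss_binomS mulr_suml.
apply: eq_bigr => j _; rewrite -mulrA; congr (_ * _).
by rewrite theta_termS -theta_term_mul //; ring.
Qed.

Lemma prod_one_sub_tail x r s :
  exists c, \prod_(m < r) (1 - x ^+ (s + m).+1) = 1 + x ^+ s.+1 * c.
Proof.
elim: r => [|r [c Ec]]; first by exists 0; rewrite big_ord0 mulr0 addr0.
exists (c - (1 + x ^+ s.+1 * c) * x ^+ r).
by rewrite big_ord_recr /= Ec -addSn exprD; ring.
Qed.

End FiniteTripleProduct.

(** * Support of the truncated triple product *)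

(* The last product runs to 2N so that it clears the denominator of every
   Gaussian binomial [2N, j]. *)
Definition triple_product (k i N : nat) : {poly int} :=
  \prod_(m < N) (1 - 'X^i * 'X^k ^+ m) *
  \prod_(m < N) (1 - 'X^(k - i) * 'X^k ^+ m) *
  \prod_(m < N + N) (1 - 'X^k ^+ m.+1).

(** With x = q^k and s = 2N - j, clearing the denominator of [2N, j] leaves two tails, 1 +
    O(x^(s+1)) and 1 + O(x^(j+1)). Times the theta term, the error terms have degree above N, so up
    to degree N only the theta terms themselves contribute. *)
Lemma triple_product_support k i N e :
    (0 < i < k)%N -> (e <= N)%N -> (triple_product k i N)`_e != 0 ->
  exists a, (e = k * 'C(a, 2) + i * a \/ e = k * 'C(a, 2) + (k - i) * a)%N.
Proof.
move=> /andP[i_gt0 ltik] leeN.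
have zwx : (- 'X^i) * (- 'X^(k - i)) = 'X^k :> {poly int}.
  by rewrite mulrNN -exprD subnKC // ltnW.
rewrite /triple_product.
under eq_bigr => m _ do rewrite -mulNr.
under [X in _ * X * _]eq_bigr => m _ do rewrite -mulNr.
rewrite finite_triple_product // mulr_suml coef_sum.
have [/existsP[j nz_j] _ | /existsPn all0] := boolP [exists j : 'I_(N + N).+1,
  (theta_term (- 'X^i) (- 'X^(k - i)) 'X^k N j : {poly int})`_e != 0].
  move: nz_j; rewrite /theta_term.
  case: ifP => _; [exists (j - N)%N; left | exists (N - j)%N; right];
  move: nz_j; rewrite exprNn -!exprM -mulrA -exprD -signr_odd mulr_sign;
  rewrite addnC; case: ifP => _; rewrite ?coefN coefXn ?oppr_eq0;
  by case: (e =P _).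
rewrite big1 ?eqxx // => j _.
have := all0 j; rewrite negbK => /eqP tj0.
have := ltn_ord j; rewrite ltnS => lej.
move: (nat_of_ord j) tj0 lej => {all0}{}j tj0 lej.
rewrite mulrAC; set s := (N + N - j)%N.
have Es : (N + N)%N = (j + s)%N by rewrite subnKC.
rewrite !Es big_split_ord /= mulrA gauss_binom_prod.
have [c ->] := prod_one_sub_tail ('X^k : {poly int}) j s.
have [d ->] := prod_one_sub_tail ('X^k : {poly int}) s j.
(* Here r + 1 >= N + 1 - |j - N|, while the theta term has degree at least |j - N| because i and k -
   i are positive. *)
have small r : (r = s \/ r = j) -> exists b : {poly int},
    'X^k ^+ r.+1 * theta_term (- 'X^i) (- 'X^(k - i)) 'X^k N j =
    b * 'X^(N.+1).
  move=> Er; rewrite /theta_term.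
  case: ifP => leNj; rewrite exprNn -!exprM -signr_odd;
    rewrite -mulrA -exprD mulrCA -exprD.
    exists ((-1) ^+ odd (j - N) *
      'X^(k * r.+1 + (i * (j - N) + k * 'C(j - N, 2)) - N.+1)).
    rewrite -mulrA -exprD subnK //; nia.
  exists ((-1) ^+ odd (N - j) *
    'X^(k * r.+1 + ((k - i) * (N - j) + k * 'C(N - j, 2)) - N.+1)).
  rewrite -mulrA -exprD subnK //; nia.
have [b Eb] := small s (or_introl erefl).
have [b' Eb'] := small j (or_intror erefl).
set t := theta_term _ _ _ _ _ in tj0 Eb Eb' *.
set A := 'X^k ^+ s.+1 in Eb *; set B := 'X^k ^+ j.+1 in Eb' *.
have -> : (1 + A * c) * (1 + B * d) * t =
    t + (c * b + d * b' + c * d * B * b) * 'X^(N.+1).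
  transitivity (t + c * (A * t) + d * (B * t) + c * d * B * (A * t)).
    by ring.
  by rewrite Eb Eb'; ring.
by rewrite coefD tj0 coefMXn ltnS leeN addr0.
Qed.

(** * Arithmetic of power series modulo q^n *)

Definition agree (n : nat) (f g : qseries) := forall j, (j < n)%N -> f j = g j.

Lemma agree_sym n f g : agree n f g -> agree n g f.
Proof. by move=> fg j ltjn; rewrite fg. Qed.

Lemma agree_trans n f g h : agree n f g -> agree n g h -> agree n f h.
Proof. by move=> fg gh j ltjn; rewrite fg ?gh. Qed.

Lemma agree_qs_mul n f g (p q : {poly int}) :
  agree n f (nth 0 p) -> agree n g (nth 0 q) ->
  agree n (qs_mul f g) (nth 0 (p * q)).
Proof.
move=> fp gq j ltjn; rewrite /qs_mul coefM; apply: eq_bigr => m _.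
by rewrite fp ?gq //; have := ltn_ord m; lia.
Qed.

Lemma agree_qpoch n (a b : {poly int}) N : b`_0 = 0 -> (n <= N)%N ->
  agree n (qpoch a b) (nth 0 (\prod_(m < N) (1 - a * b ^+ m))).
Proof.
by move=> b0 lenN j ltjn; rewrite coef_qpoch //; apply: leq_trans lenN.
Qed.

Definition eqX (n : nat) (p q : {poly int}) := agree n (nth 0 p) (nth 0 q).

Lemma eqX_refl n p : eqX n p p.
Proof. by []. Qed.

Lemma eqXM n p p' q q' : eqX n p p' -> eqX n q q' -> eqX n (p * q) (p' * q').
Proof.
move=> pp' qq'; apply: agree_trans (agree_qs_mul pp' qq').
by move=> j _; rewrite coefM.
Qed.

Lemma eqXMl n c p q : eqX n p q -> eqX n (c * p) (c * q).
Proof. exact/eqXM/eqX_refl. Qed.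

Lemma eqX_add_mulXn n p c : eqX n (p + 'X^n * c) p.
Proof. by move=> j ltjn; rewrite coefD coefXnM ltjn addr0. Qed.

Lemma eqX_inv n (p : {poly int}) : p`_0 = 1 -> exists p', eqX n (p * p') 1.
Proof.
move=> p0; have [c Ec] : exists c, 1 - p = 'X * c.
  exists (drop_poly 1 (1 - p)).
  rewrite -[LHS](poly_take_drop 1) expr1 mulrC.
  rewrite [take_poly _ _](_ : _ = 0) ?add0r //.
  by apply/polyP => -[|j]; rewrite coef_take_poly coef0 // coefB coef1 p0.
(* A truncated geometric series suffices, since q divides 1 - p. *)
exists (\sum_(i < n) (1 - p) ^+ i).
have -> : p * \sum_(i < n) (1 - p) ^+ i = 1 - (1 - p) ^+ n.
  by rewrite -[(1 - p) ^+ n](subrK 1) subrX1; ring.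
by rewrite Ec exprMn -mulrN; apply: eqX_add_mulXn.
Qed.

Lemma eqX_mulI n (p q r : {poly int}) :
  p`_0 = 1 -> eqX n (p * q) (p * r) -> eqX n q r.
Proof.
move=> /(@eqX_inv n)[p' pp'] pqr.
have inv s : eqX n (p' * (p * s)) s.
  by have := eqXM pp' (@eqX_refl n s); rewrite mul1r mulrA [p' * p]mulrC.
exact: agree_trans (agree_trans (agree_sym (inv q)) (eqXMl p' pqr)) (inv r).
Qed.

Lemma eqX_prod_one_sub k n N M : (0 < k)%N -> (n <= N)%N -> (n <= M)%N ->
  eqX n (\prod_(m < N) (1 - 'X^k ^+ m.+1)) (\prod_(m < M) (1 - 'X^k ^+ m.+1)).
Proof.
move=> k_gt0 leN leM; have Xk0 : ('X^k : {poly int})`_0 = 0.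
  by rewrite coefXn; case: k k_gt0.
have E L : \prod_(m < L) (1 - 'X^k ^+ m.+1) =
    \prod_(m < L) (1 - 'X^k * 'X^k ^+ m) :> {poly int}.
  by apply: eq_bigr => m _; rewrite exprS.
rewrite !E.
exact: agree_trans (agree_sym (agree_qpoch _ Xk0 leN)) (agree_qpoch _ Xk0 leM).
Qed.

(** * Reduction of the generating function to J P modulo 4 *)

Section Reduction.

Variables k i n : nat.
Hypothesis ik : (0 < i < k)%N.

(** [D], [E], [O] and [Q] truncate (q;q), (-q;q), (q;q^2) and (q^2;q^2). *)
Let D N : {poly int} := \prod_(m < N) (1 - 'X ^+ m.+1).
Let E N : {poly int} := \prod_(m < N) (1 + 'X ^+ m.+1).
Let O N : {poly int} := \prod_(m < N) (1 - 'X * 'X^2 ^+ m).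
Let Q N : {poly int} := \prod_(m < N) (1 - 'X^2 ^+ m.+1).
Let J := triple_product k i n.
Let P := triple_product 2 1 n.

Lemma euler_prod_coef0 N : (D N)`_0 = 1.
Proof.
rewrite -horner_coef0 horner_prod big1 // => m _.
by rewrite hornerD hornerN hornerXn hornerC exprS mul0r subr0.
Qed.

Lemma double_euler_prodE N : E N * D N = Q N.
Proof.
rewrite -big_split; apply: eq_bigr => m _ /=.
by rewrite -exprM mulnC exprM; ring.
Qed.

Lemma euler_prod_split N : Q N * O N = D (N + N).
Proof.
elim: N => [|N IHN]; first by rewrite /Q /O /D !big_ord0 mulr1.
rewrite addSn addnS /Q /O /D !big_ord_recr /= -/(Q N) -/(O N).
rewrite -/(D (N + N)) -IHN.
by rewrite -!exprM -exprS mulnS mul2n addnn; ring.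
Qed.

(** After multiplication by (q;q), both sides become (q;q)^2, through (-q;q)(q;q) = (q^2;q^2) and
    (q^2;q^2)(q;q^2) = (q;q). *)
Lemma neg_poch_mul_theta : eqX n (E n * P) (D n).
Proof.
have DD : eqX n (D (n + n)) (D n).
  have DE1 N : D N = \prod_(m < N) (1 - 'X^1 ^+ m.+1).
    by apply: eq_bigr => m _; rewrite expr1.
  by rewrite !DE1; apply: eqX_prod_one_sub => //; lia.
have QQ : eqX n (Q (n + n)) (Q n) by apply: eqX_prod_one_sub => //; lia.
have EP : P = O n * O n * Q (n + n) by rewrite /P /triple_product !expr1.
apply: (@eqX_mulI _ (D n)); first exact: euler_prod_coef0.
have -> : D n * (E n * P) = E n * D n * (O n * O n) * Q (n + n).
  by rewrite EP; ring.
rewrite double_euler_prodE.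
apply: agree_trans (eqXMl _ QQ) _.
rewrite (_ : _ * _ = (Q n * O n) * (Q n * O n)); last by ring.
by rewrite euler_prod_split; apply: eqXM.
Qed.

Lemma theta_mod2 : exists t, eqX n P (1 + 2 * t).
Proof.
have [c Ec] : exists c, E n = D n + 2 * c.
  rewrite /E /D; elim: n => [|N [c Ec]].
    by exists 0; rewrite !big_ord0 mulr0 addr0.
  rewrite !big_ord_recr /= Ec.
  by exists (c * (1 + 'X ^+ N.+1) +
    'X ^+ N.+1 * \prod_(m < N) (1 - 'X ^+ m.+1)); ring.
have [D' DD'] := eqX_inv n (euler_prod_coef0 n).
(* E = D + 2c and E P = D give D P = D - 2 c P; then divide by D. *)
exists (- (c * P * D')).
apply: (eqX_mulI (euler_prod_coef0 n)).
have -> : D n * P = E n * P + 2 * - c * P by rewrite Ec; ring.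
have -> : D n * (1 + 2 * - (c * P * D')) =
    D n + 2 * - c * P * (D n * D') by ring.
move=> j ltjn; rewrite !coefD neg_poch_mul_theta //; congr (_ + _).
by have := eqXMl (2 * - c * P) DD' ltjn; rewrite mulr1 => ->.
Qed.

(** The definition gives s D = E J, and E P = D, so D s P = E P J = D J; then cancel D. *)
Lemma S_ki_mul_theta :
  exists2 s : {poly int}, agree n (S_ki k i) (nth 0 s) & eqX n (s * P) J.
Proof.
exists (\poly_(j < n) S_ki k i j) => [j ltjn | ].
  by rewrite coef_poly ltjn.
set s := \poly_(_ < _) _.
have As : agree n (S_ki k i) (nth 0 s) by move=> j ltjn; rewrite coef_poly ltjn.
have Xk0 : ('X^k : {poly int})`_0 = 0 by rewrite coefXn; case: k ik => //; lia.
have X0 : ('X : {poly int})`_0 = 0 by rewrite coefX.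
have AD : agree n (qpoch 'X 'X) (nth 0 (D n)).
  have -> : D n = \prod_(m < n) (1 - 'X * 'X ^+ m).
    by apply: eq_bigr => m _; rewrite exprS.
  exact: agree_qpoch.
have AE : agree n (qpoch (- 'X) 'X) (nth 0 (E n)).
  have -> : E n = \prod_(m < n) (1 - - 'X * 'X ^+ m).
    by apply: eq_bigr => m _; rewrite mulNr opprK exprS.
  exact: agree_qpoch.
have AJ : agree n (qs_mul (qpoch 'X^i 'X^k)
    (qs_mul (qpoch 'X^(k - i) 'X^k) (qpoch 'X^k 'X^k))) (nth 0 J).
  rewrite /J /triple_product -mulrA.
  apply: agree_qs_mul; first exact: agree_qpoch.
  apply: agree_qs_mul; first exact: agree_qpoch.
  under eq_bigr => m _ do rewrite exprS.
  by apply: agree_qpoch => //; lia.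
have sD : eqX n (s * D n) (E n * J).
  apply: agree_trans (agree_sym (agree_qs_mul As AD)) _.
  by move=> j ltjn; rewrite S_kiP (agree_qs_mul AE AJ).
apply: (eqX_mulI (euler_prod_coef0 n)).
have -> : D n * (s * P) = P * (s * D n) by ring.
apply: agree_trans (eqXMl P sD) _.
have -> : P * (E n * J) = J * (E n * P) by ring.
by rewrite [D n * J]mulrC; apply/eqXMl/neg_poch_mul_theta.
Qed.

Lemma S_ki_mod4 j : (j < n)%N -> (S_ki k i j = (J * P)`_j %[mod 4])%Z.
Proof.
move=> ltjn; have [s As sP] := S_ki_mul_theta; have [t Pt] := theta_mod2.
(* J P = s P^2 = s (1 + 2t)^2. *)
have JP : eqX n (J * P) (s + 4 * (s * (t + t ^+ 2))).
  apply: agree_trans (eqXM (agree_sym sP) (@eqX_refl n P)) _.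
  rewrite -mulrA; have -> : s + 4 * (s * (t + t ^+ 2)) =
      s * ((1 + 2 * t) * (1 + 2 * t)).
    by ring.
  exact/eqXMl/eqXM.
by rewrite As // JP // coefD mulr_natl coefMn
  -[_`_j *+ 4]mulr_natr addrC modzMDl.
Qed.

End Reduction.

(** * Exponents modulo 9 and the vanishing of coefficients *)

Lemma double_bin2 m : (2 * 'C(m, 2) = m * m.-1)%N.
Proof.
elim: m => // m IHm; rewrite binS bin1 mulnDr IHm.
by case: m {IHm} => //= m; lia.
Qed.

Lemma bin2_mod9 a : exists b c, [\/ a = 3 * b /\ 'C(a, 2) = 9 * c + 3 * b,
   a = 3 * b + 1 /\ 'C(a, 2) = 9 * c + 6 * b |
   a = 3 * b + 2 /\ 'C(a, 2) = 9 * c + 9 * b + 1]%N.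
Proof.
exists (a %/ 3)%N, 'C(a %/ 3, 2).
have := divn_eq a 3; have := ltn_pmod a (isT : 0 < 3)%N.
have := double_bin2 a; have := double_bin2 (a %/ 3)%N.
move: (a %/ 3)%N (a %% 3)%N => b r; move: 'C(b, 2) 'C(a, 2) => c d.
case: r => [|[|[|//]]] Eb Ea _ Er.
- apply: Or31; nia.
- apply: Or32; nia.
- apply: Or33; nia.
Qed.

(** Modulo 3, e = 2 forces b = 0, with a = 2 in the first form and a = 1 in the second. Modulo 9 the
    first form is then k + 2i, which is k - i because 9 divides 3i; the second is k - i + 3 (a %/ 3)
    (3k - i), and 3 divides i. *)
Lemma exponent_mod9 k i a b e :
    (2 * i <= k)%N -> k = 2 %[mod 3] -> i = 0 %[mod 3] ->
    (e = k * 'C(a, 2) + i * a + b ^ 2 \/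
     e = k * 'C(a, 2) + (k - i) * a + b ^ 2)%N ->
  e = 2 %[mod 3] -> e = k - i %[mod 9].
Proof.
move=> leik hk hi; have [l El] : exists l, (k - i = l)%N by exists (k - i)%N.
rewrite El; have [i' Ei] : exists i', (i = 3 * i')%N by exists (i %/ 3)%N; lia.
have [l' El'] : exists l', (l = 3 * l' + 2)%N by exists (l %/ 3)%N; lia.
have Ek : (k = 3 * (i' + l') + 2)%N by lia.
have [b' [r [ltr3 Eb]]] : exists b' r, (r < 3)%N /\ (b = 3 * b' + r)%N.
  by exists (b %/ 3)%N, (b %% 3)%N; lia.
have [c [d [] [Ea ->]]] := bin2_mod9 a;
  rewrite {}Ea {}El' {}Ek {}Ei {}Eb {leik hk hi El};
  case: r ltr3 => [|[|[|//]]] _; lia.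
Qed.

Lemma S_ki_eq0_mod4 k i e :
    (0 < i)%N -> (2 * i <= k)%N -> k = 2 %[mod 3] -> i = 0 %[mod 3] ->
    e = 2 %[mod 3] -> e <> k - i %[mod 9] ->
  (S_ki k i e = 0 %[mod 4])%Z.
Proof.
move=> i_gt0 leik hk hi he ne.
have ik : (0 < i < k)%N by lia.
rewrite (@S_ki_mod4 _ _ e.+1) // coefM big1 // => j _.
have lej : (j <= e)%N by rewrite -ltnS.
apply/eqP; rewrite mulf_eq0; apply/norP => -[nzJ nzP].
have [a Ea] := triple_product_support ik (leqW lej) nzJ.
have [//|b Eb] := triple_product_support _ (leqW (leq_subr j e)) nzP.
apply: ne; apply: (@exponent_mod9 k i a b) => //.
(* For (k, i) = (2, 1) both alternatives for the exponent coincide and give a square. *)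
have bb : (2 * 'C(b, 2) + b = b ^ 2)%N.
  by rewrite double_bin2; case: (b) => //= m; lia.
by case: Ea => Ea; [left | right]; lia.
Qed.

Unset Implicit Arguments.

Theorem mainTheorem4 (k i : nat)
    (hi : (1 <= i)%N) (hik : (2 * i <= k)%N)
    (hk3 : k = 2 %[mod 3]) (hi3 : i = 0 %[mod 3]) :
  forall n : nat,
    ((k - i)%N = 2 %[mod 9] ->
       (S_ki k i (9 * n + 5)%N = 0 %[mod 4])%Z /\
       (S_ki k i (9 * n + 8)%N = 0 %[mod 4])%Z) /\
    ((k - i)%N = 5 %[mod 9] ->
       (S_ki k i (9 * n + 2)%N = 0 %[mod 4])%Z /\
       (S_ki k i (9 * n + 8)%N = 0 %[mod 4])%Z) /\
    ((k - i)%N = 8 %[mod 9] ->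
       (S_ki k i (9 * n + 2)%N = 0 %[mod 4])%Z /\
       (S_ki k i (9 * n + 5)%N = 0 %[mod 4])%Z).
Proof.
move=> n; have eq0 := @S_ki_eq0_mod4 k i _ hi hik hk3 hi3.
by split; [|split] => hki; split; apply: eq0; lia.
Qed.
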